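(* For a finite simple graph $G=(V,E)$ with complement $\overline{G}$, the following conditions are equivalent: (i) $G$ is a simple-triangle graph; (ii) $G$ has a cocomparability ordering fulfilling the $C_4$ rule; (iii) $G$ has a vertex ordering $\sigma$ containing none of the patterns (A), (B), (C) below (with respect to the edges of $G$); (iv) $\overline{G}$ has a comparability ordering fulfilling the $2K_2$ rule; (v) $\overline{G}$ has a vertex ordering $\sigma$ containing none of the patterns (Z), (B), (C) below (with respect to the edges of $\overline{G}$). Here, for a graph $H$ and a vertex ordering $\sigma$ of $H$, the patterns are: (Z) vertices $u<_\sigma v<_\sigma w$ with $uv,vw\in E(H)$ and $uw\notin E(H)$; (A) vertices $u<_\sigma v<_\sigma w$ with $uw\in E(H)$ and $uv,vw\notin E(H)$; (B) vertices $u<_\sigma v<_\sigma w<_\sigma x$ with $uw,vx\in E(H)$ and $vw,ux\notin E(H)$; (C) vertices $u<_\sigma v<_\sigma w<_\sigma x$ with $ux,vw\in E(H)$ and $uw,vx\notin E(H)$.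
   Context: Let $L_1,L_2$ be two horizontal lines in the plane with $L_1$ above $L_2$. A triangle between them is determined by a point (apex) on $L_1$ and an interval (base) on $L_2$. A graph $G$ is a simple-triangle graph if one can assign such a triangle to each vertex so that two vertices are adjacent iff their triangles intersect. A vertex ordering of $G$ is a linear ordering $\sigma$ of $V$; $u<_\sigma v$ means $u$ precedes $v$. $\sigma$ is a comparability ordering if for all $u<_\sigma v<_\sigma w$, $uv,vw\in E$ implies $uw\in E$; it is a cocomparability ordering if for all $u<_\sigma v<_\sigma w$, $uw\in E$ implies $uv\in E$ or $vw\in E$. A chordless 4-cycle $C_4=(u,v,w,x)$ is an induced cycle with edges $uv,vw,wx,xu$ and non-edges $uw,vx$; $\sigma$ fulfills the $C_4$ rule if for every such induced $C_4$, $u<_\sigma v\iff w<_\sigma v\iff w<_\sigma x\iff u<_\sigma x$. An induced $2K_2$ on $u,v,w,x$ is one whose only edges are $uw$ and $vx$; $\sigma$ fulfills the $2K_2$ rule if for every such induced $2K_2$, $u<_\sigma v\iff w<_\sigma v\iff w<_\sigma x\iff u<_\sigma x$. A vertex ordering ''contains'' a pattern if there exist vertices as described in it. *)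

(* Defs.v *)
From mathcomp Require Import all_boot all_order all_algebra.
From mathcomp Require Import classical_sets reals.

Set Implicit Arguments.
Unset Strict Implicit.
Unset Printing Implicit Defensive.

Import Order.TTheory GRing.Theory Num.Theory.
Local Open Scope classical_set_scope.
Local Open Scope ring_scope.

Record sgraph (V : finType) := SGraph {
  edge :> rel V;
  edge_sym : symmetric edge;
  edge_irr : irreflexive edge
}.

Section Complement.
Variables (V : finType) (G : sgraph V).

Definition compl_rel : rel V := fun u v => (u != v) && ~~ G u v.

Lemma compl_sym : symmetric compl_rel.
Proof. by move=> u v; rewrite /compl_rel eq_sym edge_sym. Qed.

Lemma compl_irr : irreflexive compl_rel.
Proof. by move=> u; rewrite /compl_rel eqxx. Qed.

Definition complement : sgraph V := SGraph compl_sym compl_irr.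

End Complement.

Section Triangles.
Variable R : realType.

(* Only abscissas are stored; the ordinates are those of the two lines.       *)
Record triangle := Triangle {
  apex : R;
  base_left : R;
  base_right : R;
  base_lt : base_left < base_right
}.

(* The convex hull of (apex, h1), (base_left, h2) and (base_right, h2).       *)
Definition region (h1 h2 : R) (t : triangle) : set (R * R) :=
  [set p | exists a b c : R,
    [/\ 0 <= a, 0 <= b, 0 <= c, a + b + c = 1 &
        p = (a * apex t + b * base_left t + c * base_right t,
             a * h1 + b * h2 + c * h2)]].

Definition simple_triangle_graph (h1 h2 : R) (V : finType) (G : sgraph V) :=
  exists t : V -> triangle, forall u v : V, u != v ->
    (G u v <-> region h1 h2 (t u) `&` region h1 h2 (t v) !=set0).

End Triangles.

Section Orderings.
Variable V : finType.

(* lt u v stands for u <_sigma v.                                             *)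
Definition vertex_ordering (lt : rel V) : Prop :=
  [/\ irreflexive lt, transitive lt &
      forall u v : V, u != v -> lt u v || lt v u].

Variables (H : sgraph V) (lt : rel V).

Definition comparability_ordering : Prop :=
  vertex_ordering lt /\
  forall u v w : V, lt u v -> lt v w -> H u v -> H v w -> H u w.

Definition cocomparability_ordering : Prop :=
  vertex_ordering lt /\
  forall u v w : V, lt u v -> lt v w -> H u w -> H u v \/ H v w.

Definition induced_C4 (u v w x : V) : Prop :=
  [/\ uniq [:: u; v; w; x],
      [&& H u v, H v w, H w x & H x u], ~~ H u w & ~~ H v x].

Definition induced_2K2 (u v w x : V) : Prop :=
  [/\ uniq [:: u; v; w; x], H u w, H v x &
      [&& ~~ H u v, ~~ H v w, ~~ H w x & ~~ H x u]].

Definition alternating (u v w x : V) : Prop :=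
  [/\ lt u v <-> lt w v, lt w v <-> lt w x & lt w x <-> lt u x].

Definition C4_rule : Prop :=
  forall u v w x : V, induced_C4 u v w x -> alternating u v w x.

Definition twoK2_rule : Prop :=
  forall u v w x : V, induced_2K2 u v w x -> alternating u v w x.

Definition contains_Z : Prop := exists u v w : V,
  [/\ lt u v, lt v w, H u v, H v w & ~~ H u w].

Definition contains_A : Prop := exists u v w : V,
  [/\ lt u v, lt v w, H u w, ~~ H u v & ~~ H v w].

Definition contains_B : Prop := exists u v w x : V,
  [/\ [&& lt u v, lt v w & lt w x], H u w, H v x, ~~ H v w & ~~ H u x].

Definition contains_C : Prop := exists u v w x : V,
  [/\ [&& lt u v, lt v w & lt w x], H u x, H v w, ~~ H u w & ~~ H v x].

End Orderings.

(* Main.v *)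
Require Import Defs.
From mathcomp Require Import all_boot all_order all_algebra.
From mathcomp Require Import classical_sets reals.
From mathcomp Require Import ring lra zify.
Import Order.TTheory GRing.Theory Num.Theory.
Local Open Scope ring_scope.

(** Two triangles are disjoint iff one lies strictly to the left of the other on
    both lines, so ordering the vertices by apex yields (ii).  Conversely, let
    [prec u v] mean that [u] comes before [v] and they are non-adjacent.
    Keeping the given ordering for the apices, one needs intervals on the lower
    line with [right u < left v] when [prec u v], and [left v <= right u] when
    [u <= v] but not [prec u v].  These constraints are solvable unless the
    relation [forced u u'] (some [left v] must lie between [right u] and
    [right u']) has a cycle.  Patterns (B) and (C) exclude 2-cycles; two
    consecutive steps of [forced] can be merged into one unless they end
    strictly before their starting point, so every longer cycle can be shortened
    at its least vertex. *)

(** * Intersection of triangles spanned between two horizontal lines *)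

Section Geometry.
Variables (R : realType) (h1 h2 : R).
Hypothesis h21 : h2 < h1.
Implicit Types s t : triangle R.

Definition left_of s t : bool :=
  (apex s < apex t) && (base_right s < base_left t).

Lemma base_sub_region t x :
  base_left t <= x <= base_right t -> region h1 h2 t (x, h2).
Proof.
move=> /andP[lx xr]; have lr := base_lt t.
have d0 : 0 < base_right t - base_left t by rewrite subr_gt0.
have dn0 := lt0r_neq0 d0.
exists 0, ((base_right t - x) / (base_right t - base_left t)),
  ((x - base_left t) / (base_right t - base_left t)).
split; [by []| | | |].
- by apply: divr_ge0; lra.
- by apply: divr_ge0; lra.
- by field.
- by congr (_, _); field.
Qed.

Lemma region_left_side t k : 0 <= k <= 1 ->
  region h1 h2 t (k * apex t + (1 - k) * base_left t, k * h1 + (1 - k) * h2).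
Proof.
move=> /andP[k0 k1]; exists k, (1 - k), 0; split => //.
- by rewrite subr_ge0.
- by ring.
- by congr (_, _); ring.
Qed.

Lemma region_right_side t k : 0 <= k <= 1 ->
  region h1 h2 t (k * apex t + (1 - k) * base_right t, k * h1 + (1 - k) * h2).
Proof.
move=> /andP[k0 k1]; exists k, 0, (1 - k); split => //.
- by rewrite subr_ge0.
- by ring.
- by congr (_, _); ring.
Qed.

(** Points at a common height give the same weight [a] to the apex, since [h1] and [h2] differ. At
    that height, every point of [s] is strictly left of every point of [t]. *)
Lemma left_of_disjoint s t :
  left_of s t -> ~ (region h1 h2 s `&` region h1 h2 t !=set0)%classic.
Proof.
move=> /andP[ast rst] [p []].
move=> [a [b [c [a0 b0 c0 s1 ->]]]] [a' [b' [c' [a0' b0' c0' s1' [ex ey]]]]].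
have ls := base_lt s; have lt := base_lt t.
have eh : (a - a') * (h1 - h2) = 0.
  rewrite -[RHS](subrr (a * h1 + b * h2 + c * h2)) {2}ey.
  have -> : b = 1 - a - c by lra.
  have -> : b' = 1 - a' - c' by lra.
  by ring.
move/eqP: eh; rewrite mulf_eq0 !subr_eq0 (gt_eqF h21) orbF => /eqP eaa.
subst a'.
have bs : b * base_left s <= b * base_right s.
  by apply: ler_wpM2l => //; exact: ltW.
have ct : c' * base_left t <= c' * base_right t.
  by apply: ler_wpM2l => //; exact: ltW.
have ha : a * apex s <= a * apex t by apply: ler_wpM2l => //; exact: ltW.
have hb : (b + c) * base_right s <= (b + c) * base_left t.
  by apply: ler_wpM2l; rewrite ?addr_ge0 // ltW.
have ebc : b' + c' = b + c by lra.
have ebl : (b + c) * base_left t = (b' + c') * base_left t by rewrite ebc.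
have : a * apex s + (b + c) * base_right s < a * apex t + (b + c) * base_left t.
  (* Strictness comes from the apices when [a] is positive, and otherwise from the bases, whose
     total weight is then 1. *)
  have [ap|] := ltP 0 a.
    by apply: ltr_leD => //; rewrite ltr_pM2l.
  move=> a00; apply: ler_ltD => //; rewrite ltr_pM2l //; lra.
rewrite ebl; rewrite !mulrDl in hb *; lra.
Qed.

(** Equal apices are a common point. Otherwise either the bases overlap, or the base of [t] lies
    left of that of [s] while the apices are in the opposite order, so the left side of [s] crosses
    the right side of [t]. *)
Lemma meet_of_apex_le s t : apex s <= apex t -> ~~ left_of s t ->
  (region h1 h2 s `&` region h1 h2 t !=set0)%classic.
Proof.
rewrite le_eqVlt => /orP[/eqP ast _|ast].
  have k01 : 0 <= (1 : R) <= 1 by rewrite ler01 lexx.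
  have := region_left_side t 1 k01; have := region_left_side s 1 k01.
  by rewrite !subrr !mul0r ast => ? ?; eexists; split; eassumption.
rewrite /left_of ast /= -leNgt => ll.
have ls := base_lt s; have lt := base_lt t.
have [rl|lr] := ltP (base_right t) (base_left s).
  have d0 : 0 < (base_left s - base_right t) + (apex t - apex s) by lra.
  have dn0 := lt0r_neq0 d0.
  (* The relative height at which these two sides have the same abscissa. *)
  pose k := (base_left s - base_right t) /
    ((base_left s - base_right t) + (apex t - apex s)).
  have k01 : 0 <= k <= 1.
    apply/andP; split; first by apply: divr_ge0; lra.
    by rewrite ler_pdivrMr // mul1r; lra.
  exists (k * apex s + (1 - k) * base_left s, k * h1 + (1 - k) * h2).
  split; first exact: region_left_side.
  have -> : k * apex s + (1 - k) * base_left s =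
            k * apex t + (1 - k) * base_right t by rewrite /k; field.
  exact: region_right_side.
exists (Num.max (base_left s) (base_left t), h2).
by split; apply: base_sub_region; rewrite ge_max le_max lexx ?orbT /=; lra.
Qed.

Lemma regions_meetP s t :
  (region h1 h2 s `&` region h1 h2 t !=set0)%classic <->
  ~~ left_of s t && ~~ left_of t s.
Proof.
split=> [st|/andP[nst nts]].
  apply/andP; split; apply/negP; first by move/left_of_disjoint.
  by move/left_of_disjoint; rewrite setIC.
have [ast|/ltW ats] := leP (apex s) (apex t); first exact: meet_of_apex_le.
by rewrite setIC; exact: meet_of_apex_le.
Qed.

End Geometry.

Arguments left_of {R} s t.

(** * The C4 rule and the forbidden patterns *)

Section Orders.
Variables (V : finType) (G : sgraph V) (lt : rel V).
Hypothesis lt_order : vertex_ordering lt.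

Let lt_irr : irreflexive lt. Proof. by case: lt_order. Qed.
Let lt_trans : transitive lt. Proof. by case: lt_order. Qed.
Let lt_total u v : u != v -> lt u v || lt v u.
Proof. by case: lt_order => _ _; apply. Qed.

Lemma vertex_ordering_asym u v : lt u v -> lt v u = false.
Proof. by move=> uv; apply/negP => /(lt_trans _ _ _ uv); rewrite lt_irr. Qed.

Lemma vertex_ordering_neq u v : lt u v -> u != v.
Proof. by apply: contraTneq => ->; rewrite lt_irr. Qed.

(** The C4 rule says that one diagonal pair lies entirely before the other. Swapping the ends of a
    diagonal keeps the 4-cycle induced, so each diagonal may be taken in increasing order; then one
    comparison separates the pairs. *)
Lemma C4_rule_of_separated :
  (forall u v w x, induced_C4 G u v w x -> lt u w -> lt v x ->
     lt w v \/ lt x u) ->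
  C4_rule G lt.
Proof.
move=> sep u v w x.
have before a b c d : lt a b -> lt c d -> lt b c ->
    [/\ lt a c, lt a d, lt b c & lt b d].
  move=> ab cd bc; have bd := lt_trans _ _ _ bc cd.
  by split=> //; [exact: lt_trans ab bc | exact: lt_trans ab bd].
have sep4 a b c d : induced_C4 G a b c d -> lt a c -> lt b d ->
    [/\ lt a b, lt a d, lt c b & lt c d] \/
    [/\ lt b a, lt b c, lt d a & lt d c].
  move=> C4 ac bd; case: (sep _ _ _ _ C4 ac bd) => h; [left|right].
    by case: (before _ _ _ _ ac bd h).
  by case: (before _ _ _ _ bd ac h).
have swap1 a b c d : induced_C4 G a b c d -> induced_C4 G c b a d.
  case=> un /and4P[ab bc cd da] ac bd; split => //.
  - rewrite (perm_uniq (s2 := [:: a; b; c; d])) //.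
    by apply/permP => p /=; lia.
  - by rewrite edge_sym bc edge_sym ab edge_sym da edge_sym cd.
  - by rewrite edge_sym.
have swap2 a b c d : induced_C4 G a b c d -> induced_C4 G a d c b.
  case=> un /and4P[ab bc cd da] ac bd; split => //.
  - rewrite (perm_uniq (s2 := [:: a; b; c; d])) //.
    by apply/permP => p /=; lia.
  - by rewrite edge_sym da edge_sym cd edge_sym bc edge_sym ab.
  - by rewrite edge_sym.
move=> C4; have [un _ _ _] := C4.
have [uw vx] : u != w /\ v != x.
  by move: un; rewrite /= !inE !negb_or => /and4P[/and3P[_ -> _] /andP[_ ->]].
have [[uv ux wv wx]|[vu vw xu xw]] :
    [/\ lt u v, lt u x, lt w v & lt w x] \/
    [/\ lt v u, lt v w, lt x u & lt x w].
- case/orP: (lt_total _ _ uw) => {}uw; case/orP: (lt_total _ _ vx) => {}vx.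
  + by case: (sep4 _ _ _ _ C4 uw vx) => -[? ? ? ?]; [left|right].
  + by case: (sep4 _ _ _ _ (swap2 _ _ _ _ C4) uw vx) => -[? ? ? ?]; [left|right].
  + by case: (sep4 _ _ _ _ (swap1 _ _ _ _ C4) uw vx) => -[? ? ? ?]; [left|right].
  + have C4' := swap1 _ _ _ _ (swap2 _ _ _ _ C4).
    by case: (sep4 _ _ _ _ C4' uw vx) => -[? ? ? ?]; [left|right].
- by split; rewrite ?uv ?ux ?wv ?wx.
- have [uvF wvF] := (vertex_ordering_asym _ _ vu, vertex_ordering_asym _ _ vw).
  have [uxF wxF] := (vertex_ordering_asym _ _ xu, vertex_ordering_asym _ _ xw).
  by split; rewrite ?uvF ?wvF ?uxF ?wxF.
Qed.

Lemma cocomparability_no_A :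
  cocomparability_ordering G lt <-> ~ contains_A G lt.
Proof.
split=> [[_ coc] [u [v [w [uv vw uw nuv nvw]]]]|nA].
  by case: (coc _ _ _ uv vw uw); apply/negP.
split=> // u v w uv vw Guw.
have [|nuv] := boolP (G u v); first by left.
have [|nvw] := boolP (G v w); first by right.
by case: nA; exists u, v, w.
Qed.

(** In (B) and in (C) the cocomparability property makes [u v] and [w x] edges, which completes an
    induced 4-cycle. Its diagonals are nested for (B) and interleaved for (C), never separated. *)
Lemma no_patterns_of_C4_rule :
  cocomparability_ordering G lt -> C4_rule G lt ->
  [/\ ~ contains_A G lt, ~ contains_B G lt & ~ contains_C G lt].
Proof.
move=> cocG C4; have [_ coc] := cocG.
have uniq4 u v w x : lt u v -> lt v w -> lt w x -> uniq [:: u; v; w; x].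
  move=> uv vw wx; apply: (sorted_uniq lt_trans lt_irr).
  by rewrite /= uv vw wx.
split.
- exact/cocomparability_no_A.
- move=> [u [v [w [x [/and3P[uv vw wx] Guw Gvx nvw nux]]]]].
  have Guv : G u v by case: (coc _ _ _ uv vw Guw) => //; rewrite (negPf nvw).
  have Gwx : G w x by case: (coc _ _ _ vw wx Gvx) => //; rewrite (negPf nvw).
  have [|e _ _] := C4 u v x w.
    split => //.
    + rewrite (perm_uniq (s2 := [:: u; v; w; x])) ?uniq4 //.
      by apply/permP => p /=; lia.
    + by rewrite Guv Gvx edge_sym Gwx edge_sym Guw.
  by move/e: uv; rewrite vertex_ordering_asym // (lt_trans _ _ _ vw wx).
- move=> [u [v [w [x [/and3P[uv vw wx] Gux Gvw nuw nvx]]]]].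
  have Guv : G u v.
    have vx := lt_trans _ _ _ vw wx.
    by case: (coc _ _ _ uv vx Gux) => //; rewrite (negPf nvx).
  have Gwx : G w x.
    have uw := lt_trans _ _ _ uv vw.
    by case: (coc _ _ _ uw wx Gux) => //; rewrite (negPf nuw).
  have [|e _ _] := C4 u v w x.
    by split; rewrite ?uniq4 // Guv Gvw Gwx edge_sym Gux.
  by move/e: uv; rewrite vertex_ordering_asym.
Qed.

(** If the increasing diagonals [u w] and [v x] are not separated, then [u] and [v] both precede [w]
    and [x]. Each of the four remaining orders is an instance of (B) or (C). *)
Lemma C4_rule_of_no_patterns :
  ~ contains_B G lt -> ~ contains_C G lt -> C4_rule G lt.
Proof.
move=> nB nC; apply: C4_rule_of_separated => u v w x.
move=> [un /and4P[Guv Gvw Gwx Gxu] nuw nvx] uw vx.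
move: un; rewrite /= !inE !negb_or => /and4P[/and3P[uv _ ux] /andP[vw _] wx _].
case/orP: (lt_total _ _ vw) => {}vw; last by left.
case/orP: (lt_total _ _ ux) => {}ux; last by right.
case/orP: (lt_total _ _ uv) => {}uv; case/orP: (lt_total _ _ wx) => {}wx.
- by case: nC; exists u, v, w, x; split; rewrite ?uv ?vw // edge_sym.
- by case: nB; exists u, v, x, w; split; rewrite ?uv ?vx // edge_sym.
- by case: nB; exists v, u, w, x; split; rewrite ?uv ?uw // edge_sym.
- by case: nC; exists v, u, x, w; split; rewrite ?uv ?ux // edge_sym.
Qed.

(** * Passing to the complement graph *)

Lemma complement_edge u v : lt u v -> complement G u v = ~~ G u v.
Proof. by move=> uv; rewrite /= /compl_rel vertex_ordering_neq. Qed.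

Lemma contains_Z_complement : contains_Z (complement G) lt <-> contains_A G lt.
Proof.
split=> -[u [v [w [uv vw]]]]; have uw := lt_trans _ _ _ uv vw.
  by rewrite !complement_edge // negbK => ? ? ?; exists u, v, w.
by move=> ? ? ?; exists u, v, w; split; rewrite // !complement_edge ?negbK.
Qed.

(** The edges prescribed by (B) are the non-edges prescribed by (C) and conversely, so
    complementation exchanges the two patterns. *)
Lemma contains_B_complement : contains_B (complement G) lt <-> contains_C G lt.
Proof.
split=> -[u [v [w [x [/and3P[uv vw wx]]]]]];
  have [uw vx] := (lt_trans _ _ _ uv vw, lt_trans _ _ _ vw wx);
  have ux := lt_trans _ _ _ uv vx.
  rewrite !complement_edge // !negbK => ? ? ? ?.
  by exists u, v, w, x; split; rewrite ?uv ?vw.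
move=> ? ? ? ?; exists u, v, w, x; split; rewrite ?uv ?vw //;
  by rewrite complement_edge ?negbK.
Qed.

Lemma contains_C_complement : contains_C (complement G) lt <-> contains_B G lt.
Proof.
split=> -[u [v [w [x [/and3P[uv vw wx]]]]]];
  have [uw vx] := (lt_trans _ _ _ uv vw, lt_trans _ _ _ vw wx);
  have ux := lt_trans _ _ _ uv vx.
  rewrite !complement_edge // !negbK => ? ? ? ?.
  by exists u, v, w, x; split; rewrite ?uv ?vw.
move=> ? ? ? ?; exists u, v, w, x; split; rewrite ?uv ?vw //;
  by rewrite complement_edge ?negbK.
Qed.

Lemma comparability_complement :
  comparability_ordering (complement G) lt <-> cocomparability_ordering G lt.
Proof.
rewrite cocomparability_no_A -contains_Z_complement; split.
  move=> [_ com] [u [v [w [uv vw Huv Hvw]]]].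
  by rewrite (com _ _ _ uv vw Huv Hvw).
move=> nZ; split=> // u v w uv vw Huv Hvw; apply: contraT => nuw.
by case: nZ; exists u, v, w.
Qed.

Lemma twoK2_rule_complement : twoK2_rule (complement G) lt <-> C4_rule G lt.
Proof.
have K2C4 u v w x : induced_2K2 (complement G) u v w x <-> induced_C4 G u v w x.
  rewrite /induced_2K2 /induced_C4 /= /compl_rel.
  split=> -[un]; have := un; rewrite /= !inE !negb_or;
    move=> /and4P[/and3P[uv uw ux] /andP[vw vx] wx _];
    rewrite uv uw vw vx wx (eq_sym x) ux /= ?negbK.
    by move=> ? ? ?; split.
  by move=> ? ? ?; split.
by split=> h u v w x /K2C4 /h.
Qed.

End Orders.

(** * Triangles built from a pattern-free ordering *)

Section Representation.
Variables (V : finType) (G : sgraph V) (lt : rel V).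
Hypothesis lt_order : vertex_ordering lt.
Hypothesis nA : ~ contains_A G lt.
Hypothesis nB : ~ contains_B G lt.
Hypothesis nC : ~ contains_C G lt.

Let lt_irr : irreflexive lt. Proof. by case: lt_order. Qed.
Let lt_trans : transitive lt. Proof. by case: lt_order. Qed.
Let lt_total u v : u != v -> lt u v || lt v u.
Proof. by case: lt_order => _ _; apply. Qed.

Definition prec u v := lt u v && ~~ G u v.

Lemma prec_trans : transitive prec.
Proof.
move=> v u w /andP[uv nuv] /andP[vw nvw].
rewrite /prec (lt_trans _ _ _ uv vw) /=; apply/negP => Guw.
by case: nA; exists u, v, w.
Qed.

(** The case [u == v] is included so that the constraint on the ends also makes each base
    nondegenerate. *)
Definition meets u v := ((u == v) || lt u v) && ~~ prec u v.

Definition forced u u' := [exists v, prec u v && meets u' v].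

Lemma forced_irr u : ~~ forced u u.
Proof. by apply/negP => /existsP[v /and3P[-> ]]. Qed.

(** Both [u1] and [u2] precede both witnesses [v1] and [v2], with edges [u1 v1], [u2 v2] and
    non-edges [u1 v2], [u2 v1]. Whatever the order within each pair, this is (B) or (C). *)
Lemma forced_asym u1 u2 : forced u1 u2 -> forced u2 u1 -> False.
Proof.
move=> /existsP[v2 /and3P[p12 l22 n22]] /existsP[v1 /and3P[p21 l11 n11]].
(* If a vertex coincided with its witness, transitivity of [prec] would contradict the other [meets]
   condition. *)
have {l22} l22 : lt u2 v2.
  case/orP: l22 => // /eqP e; move: n11.
  by rewrite (prec_trans _ _ _ p12) // -e.
have {l11} l11 : lt u1 v1.
  case/orP: l11 => // /eqP e; move: n22.
  by rewrite (prec_trans _ _ _ p21) // -e.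
have u12 : u1 != u2 by apply: contraNneq n22 => <-.
have v12 : v1 != v2 by apply: contraNneq n22 => <-.
move: p12 p21 n11 n22; rewrite /prec l11 l22 /= !negbK.
move=> /andP[p12 n12] /andP[p21 n21] g11 g22.
case/orP: (lt_total _ _ u12) => {}u12; case/orP: (lt_total _ _ v12) => {}v12.
- by case: nB; exists u1, u2, v1, v2; split; rewrite ?u12 ?p21.
- by case: nC; exists u1, u2, v2, v1; split; rewrite ?u12 ?l22.
- by case: nC; exists u2, u1, v1, v2; split; rewrite ?u12 ?l11.
- by case: nB; exists u2, u1, v2, v1; split; rewrite ?u12 ?p12.
Qed.

(** Let [v] witness the second step. If [prec u1 v], it also witnesses [forced u1 u3]; if
    [meets u1 v], it witnesses [forced u2 u1], against asymmetry; otherwise [u1] comes after [v],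
    hence after [u3]. *)
Lemma forced_merge u1 u2 u3 :
  forced u1 u2 -> forced u2 u3 -> forced u1 u3 \/ lt u3 u1.
Proof.
move=> f12 /existsP[v /and3P[p2 l3 n3]].
have [p1|n1] := boolP (prec u1 v).
  by left; apply/existsP; exists v; rewrite p1 /meets l3.
have [l1|] := boolP ((u1 == v) || lt u1 v).
  case: (forced_asym _ _ f12); apply/existsP; exists v.
  by rewrite p2 /meets l1.
rewrite negb_or => /andP[neq nlt]; right.
have := lt_total _ _ neq; rewrite (negPf nlt) /= => vu.
by case/orP: l3 => [/eqP -> //|l3]; exact: lt_trans l3 vu.
Qed.

Lemma exists_lt_min (s : seq V) : s != [::] ->
  exists2 x, x \in s & forall y, y \in s -> ~~ lt y x.
Proof.
elim: s => // a s IH _; have [->|s0] := eqVneq s [::].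
  exists a; rewrite ?mem_head // => y.
  by rewrite inE => /eqP ->; rewrite lt_irr.
have [x xs minx] := IH s0; have [ax|nax] := boolP (lt a x).
  exists a; rewrite ?mem_head // => y; rewrite inE => /orP[/eqP ->|ys].
    by rewrite lt_irr.
  by apply: contra (minx _ ys) => ya; exact: lt_trans ya ax.
by exists x => [|y]; rewrite inE ?xs ?orbT // => /orP[/eqP ->|/minx].
Qed.

Lemma forced_acyclic (c : seq V) : c != [::] -> ~~ cycle forced c.
Proof.
have [n] := ubnP (size c); elim: n c => // n IH c szc c0; apply/negP => cyc.
(* Starting the cycle at its least vertex rules out the second outcome of [forced_merge], so the
   first two steps merge and the cycle gets shorter. *)
have [x xc minx] := exists_lt_min _ c0.
have [i c' cE] := rot_to xc.
have {xc} minx' y : y \in x :: c' -> ~~ lt y x.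
  by rewrite -cE mem_rot; exact: minx.
have {cyc} : cycle forced (x :: c') by rewrite -cE rot_cycle.
have {szc} : (size (x :: c') < n.+1)%N by rewrite -cE size_rot.
clear cE; case: c' minx' => [|y [|z c']] minx' szc.
- by rewrite /= andbT => h; move: (forced_irr x); rewrite h.
- by rewrite /= andbT => /andP[]; exact: forced_asym.
rewrite /= => /and3P[xy yz zc].
have xz : forced x z.
  case: (forced_merge _ _ _ xy yz) => // zx.
  by move: (minx' z); rewrite !inE eqxx !orbT zx => /(_ isT).
by have := IH (x :: z :: c') szc isT; rewrite /= xz zc.
Qed.

(** Counting ancestors gives a numbering that strictly increases along the acyclic relation
    [forced]. *)
Definition height u := #|[set u' | connect forced u' u]|.

Lemma height_forced u w : forced u w -> (height u < height w)%N.
Proof.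
move=> uw; apply: proper_card; apply/properP; split.
  apply/fintype.subsetP => x; rewrite !inE => xu.
  exact: connect_trans xu (connect1 uw).
exists w; rewrite inE ?connect0 //; apply/negP => /connectP[p wp up].
have := forced_acyclic (w :: p) isT.
by rewrite /= rcons_path wp -up uw.
Qed.

(** Right ends are even, so the successor of one still lies below the right end of any greater
    height; left ends use these gaps. A vertex without [prec]-predecessors gets the empty maximum 0
    as left end, below every right end. *)
Definition right_end u := (height u).*2.+2.
Definition left_end v := (\max_(u | prec u v) (right_end u).+1)%N.

Lemma left_end_gt u v : prec u v -> (right_end u < left_end v)%N.
Proof. by move=> uv; apply: (bigop.bigmax_sup u uv). Qed.

Lemma left_end_lt u v : meets u v -> (left_end v < right_end u)%N.
Proof.
move=> uv; rewrite /left_end ltnS; apply/bigop.bigmax_leqP => u' pu'v.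
have : forced u' u by apply/existsP; exists v; rewrite pu'v.
by move/height_forced; rewrite /right_end; lia.
Qed.

Definition position u := #|[set x | lt x u]|.

Lemma position_lt u v : lt u v -> (position u < position v)%N.
Proof.
move=> uv; apply: proper_card; apply/properP; split.
  by apply/fintype.subsetP => x; rewrite !inE => xu; exact: lt_trans xu uv.
by exists u; rewrite inE ?lt_irr.
Qed.

Lemma simple_triangle_of_no_patterns (R : realType) (h1 h2 : R) :
  h2 < h1 -> simple_triangle_graph h1 h2 G.
Proof.
move=> h21.
have base v : (left_end v)%:R < (right_end v)%:R :> R.
  by rewrite ltr_nat left_end_lt // /meets eqxx /prec lt_irr.
pose t v := Triangle (position v)%:R (base v).
(* The apices follow [lt], so only the bases decide: [prec u v] separates them, and [meets u v]
   prevents it. *)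
have left_ofE u v : lt u v -> left_of (t u) (t v) = ~~ G u v.
  move=> uv; rewrite /left_of /= !ltr_nat position_lt //=.
  have [Guv|nuv] := boolP (G u v); last by rewrite left_end_gt // /prec uv.
  apply/negbTE; rewrite -leqNgt ltnW // left_end_lt //.
  by rewrite /meets /prec uv Guv orbT.
have left_ofF u v : lt u v -> left_of (t v) (t u) = false.
  move=> uv; rewrite /left_of /= !ltr_nat; apply/negbTE; rewrite negb_and.
  by rewrite -leqNgt ltnW ?position_lt.
exists t => u v neq; rewrite regions_meetP //.
case/orP: (lt_total _ _ neq) => uv.
  by rewrite (left_ofE _ _ uv) (left_ofF _ _ uv) negbK andbT.
by rewrite (left_ofE _ _ uv) (left_ofF _ _ uv) negbK edge_sym.
Qed.

End Representation.

(** * Orderings read off a triangle representation *)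

Lemma vertex_ordering_enum_rank (V : finType) :
  vertex_ordering (fun u v : V => (enum_rank u < enum_rank v)%N).
Proof.
split=> [u|v u w|u v neq]; rewrite ?ltnn //; first exact: ltn_trans.
by rewrite -neq_ltn; apply: contra neq => /eqP /val_inj /enum_rank_inj ->.
Qed.

(** Lets vertices be sorted by a coordinate that need not be injective, ties being left to a given
    ordering. *)
Lemma vertex_ordering_lexi (d : Order.disp_t) (T : orderType d) (V : finType)
    (f : V -> T) (lt : rel V) : vertex_ordering lt ->
  vertex_ordering (fun u v => (f u < f v)%O || (f u == f v) && lt u v).
Proof.
move=> [irr tr tot]; split=> [u|v u w|u v neq].
- by rewrite ltxx irr andbF.
- case/orP=> [uv|/andP[/eqP uv luv]] /orP[vw|/andP[/eqP vw lvw]].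
  + by rewrite (lt_trans uv vw).
  + by rewrite -vw uv.
  + by rewrite uv vw.
  + by rewrite uv vw eqxx (tr _ _ _ luv lvw) orbT.
- by case: ltgtP => //= _; exact: tot.
Qed.

Lemma C4_ordering_of_simple_triangle (R : realType) (h1 h2 : R) (V : finType)
    (G : sgraph V) : h2 < h1 -> simple_triangle_graph h1 h2 G ->
  exists lt : rel V, cocomparability_ordering G lt /\ C4_rule G lt.
Proof.
move=> h21 [t tG].
(* Vertices sharing an apex are ordered by decreasing base: an arbitrary
   tie-break can violate the C4 rule. *)
pose lt u v := (apex (t u) < apex (t v)) || (apex (t u) == apex (t v)) &&
  ((- base_left (t u) < - base_left (t v)) ||
   (- base_left (t u) == - base_left (t v)) && (enum_rank u < enum_rank v)%N).
have lt_order : vertex_ordering lt.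
  exact/vertex_ordering_lexi/vertex_ordering_lexi/vertex_ordering_enum_rank.
have lt_apex u v : lt u v -> apex (t u) <= apex (t v).
  by case/orP => [/ltW //|/andP[/eqP -> _]].
have GE u v : lt u v -> G u v = ~~ left_of (t u) (t v).
  move=> uv; have neq := vertex_ordering_neq _ _ lt_order _ _ uv.
  have nvu : ~~ left_of (t v) (t u).
    by rewrite /left_of negb_and -leNgt lt_apex.
  apply/idP/idP => [/(tG _ _ neq)|nuv].
    by move/(regions_meetP _ _ _ h21) => /andP[].
  by apply/(tG _ _ neq)/(regions_meetP _ _ _ h21); rewrite nuv.
have nGP u v : lt u v -> ~~ G u v -> left_of (t u) (t v).
  by move=> uv; rewrite GE // negbK.
(* If the bases were separated, adjacency would force equal apices, and the tie-break would put the
   left end of [v] at or before that of [u]. *)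
have adjacent_base u v : lt u v -> G u v ->
    base_left (t v) <= base_right (t u).
  move=> uv; rewrite GE // => nuv; rewrite leNgt; apply/negP => ruv.
  move: nuv uv; rewrite /left_of ruv andbT /lt => /negPf -> /= /andP[_].
  have := base_lt (t u); rewrite ltrN2 eqr_opp => lu.
  by have luv := lt_trans lu ruv; rewrite (lt_gtF luv) (lt_eqF luv).
have [_ ltT ltt] := lt_order.
exists lt; split.
  apply/(cocomparability_no_A _ _ _ lt_order) => -[u [v [w]]].
  move=> [uv vw + nuv nvw]; rewrite GE ?(ltT _ _ _ uv vw) //; apply/negP; rewrite negbK.
  have /andP[a1 b1] := nGP _ _ uv nuv; have /andP[a2 b2] := nGP _ _ vw nvw.
  rewrite /left_of (lt_trans a1 a2) (lt_trans b1) // (lt_trans _ b2) //.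
  exact: base_lt.
apply: (C4_rule_of_separated _ _ _ lt_order) => u v w x.
move=> [un /and4P[Guv Gvw Gwx Gxu] nuw nvx] uw vx.
move: un; rewrite /= !inE !negb_or => /and4P[/and3P[_ _ ux] /andP[vw _] _ _].
case/orP: (ltt _ _ vw) => {}vw; last by left.
case/orP: (ltt _ _ ux) => {}ux; last by right.
(* Unseparated diagonals give a cycle of inequalities: right of [u] < left of [w] <= right of [v] <
   left of [x] <= right of [u]. *)
have /andP[_ ruw] := nGP _ _ uw nuw; have /andP[_ rvx] := nGP _ _ vx nvx.
have wv := adjacent_base _ _ vw Gvw.
have xu : base_left (t x) <= base_right (t u).
  by apply: adjacent_base => //; rewrite edge_sym.
by lra.
Qed.

(** * The five conditions, each implying the next and the last implying the first *)

Theorem theorem4 (R : realType) (h1 h2 : R) (h21 : h2 < h1)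
    (V : finType) (G : sgraph V) :
  [<-> (* (i) *) simple_triangle_graph h1 h2 G;
       (* (ii) *)
       exists lt : rel V, cocomparability_ordering G lt /\ C4_rule G lt;
       (* (iii) *)
       exists lt : rel V,
         [/\ vertex_ordering lt, ~ contains_A G lt, ~ contains_B G lt
           & ~ contains_C G lt];
       (* (iv) *)
       exists lt : rel V,
         comparability_ordering (complement G) lt /\
         twoK2_rule (complement G) lt;
       (* (v) *)
       exists lt : rel V,
         [/\ vertex_ordering lt, ~ contains_Z (complement G) lt,
             ~ contains_B (complement G) lt & ~ contains_C (complement G) lt]].
Proof.
tfae.
- exact: C4_ordering_of_simple_triangle.
- move=> [lt [coc C4]]; have [o _] := coc; exists lt.
  by have [] := no_patterns_of_C4_rule _ _ _ o coc C4.
- move=> [lt [o nA nB nC]]; exists lt.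
  rewrite comparability_complement // cocomparability_no_A //.
  by rewrite twoK2_rule_complement //; split=> //; exact: C4_rule_of_no_patterns.
- move=> [lt [com K2]]; have [o _] := com; exists lt.
  have /(comparability_complement _ _ _ o) coc := com.
  have [nA nB nC] := no_patterns_of_C4_rule _ _ _ o coc
    (iffLR (twoK2_rule_complement _ _ _) K2).
  by split=> // [/contains_Z_complement|/contains_B_complement
    |/contains_C_complement] => /(_ o).
(* Since complementation exchanges (B) and (C), the hypotheses on these two patterns are used
   crosswise. *)
- move=> [lt [o nZ nB nC]]; apply: (simple_triangle_of_no_patterns _ _ lt) => //.
  + by move/(contains_Z_complement _ _ _ o).
  + by move/(contains_C_complement _ _ _ o).
  + by move/(contains_B_complement _ _ _ o).
Qed.
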